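(* Let $q=ef+1$ be a prime power with $e,f>1$, and let $\epsilon>1$ be a proper divisor of $e$ (so $e>\epsilon$). Suppose $C_0^\epsilon$ is a proper $(q,\frac{ef}{\epsilon},\lambda,\mu)$-partial difference set and let ${C_0^\epsilon}'=\{C_0^e,C_\epsilon^e,\ldots,C_{e-\epsilon}^e\}$. (i) If $\phi_i\neq\phi_j$ for some distinct $i,j\in\{1,\ldots,\epsilon-1\}$, then ${C_0^\epsilon}'$ is neither a disjoint partial difference family nor an external partial difference family. Otherwise, let $\kappa=\phi_1-\phi_0$. Then: (ii) when $\kappa=0$, ${C_0^\epsilon}'$ is a $(q,\frac{e}{\epsilon},f,\frac{f-1}{\epsilon})$-disjoint difference family and a $(q,\frac{e}{\epsilon},f,\lambda-\frac{f-1}{\epsilon},\mu-\frac{f-1}{\epsilon})$-external partial difference family; (iii) when $\kappa=\mu-\lambda$, ${C_0^\epsilon}'$ is a $(q,\frac{e}{\epsilon},f,\frac{(e-\epsilon)f}{\epsilon^2})$-external difference family and a $(q,\frac{e}{\epsilon},f,\lambda-\frac{(e-\epsilon)f}{\epsilon^2},\mu-\frac{(e-\epsilon)f}{\epsilon^2})$-disjoint partial difference family; (iv) when $\kappa\notin\{0,\mu-\lambda\}$, ${C_0^\epsilon}'$ is a proper $(q,\frac{e}{\epsilon},f,\phi_0,\phi_0+\kappa)$-disjoint partial difference family and a proper $(q,\frac{e}{\epsilon},f,\lambda-\phi_0,\mu-\phi_0-\kappa)$-external partial difference family.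
   Context: $G=(GF(q),+)$, $G^*=G\setminus\{0\}$; $\alpha$ a primitive element; $C_i^d=\alpha^i\langle\alpha^d\rangle$ for $d\mid q-1$. For $0\le i\le\epsilon-1$, $\Phi_i=\{x\in C_0^e:x\neq1,\ x-1\in\alpha^iC_0^\epsilon\}$ and $\phi_i=|\Phi_i|$. $\Delta(D)$ is the multiset $\{x-y:x,y\in D,x\neq y\}$, $\Delta(D_1,D_2)$ the multiset $\{x-y:x\in D_1,y\in D_2\}$, $\lambda A$ is $\lambda$ copies of each element of $A$. $P$ is a $(q,k,\lambda,\mu)$-partial difference set if $|P|=k$ and $\Delta(P)=\lambda P+\mu(G^*\setminus P)$, proper if $\lambda\neq\mu$. For a family of $m$ disjoint $k$-subsets $D_i$ of $G^*$ with union $S$: $(q,m,k,\lambda)$-disjoint difference family means $\bigcup_i\Delta(D_i)=\lambda G^*$; $(q,m,k,\lambda)$-external difference family means $\bigcup_{i\neq j}\Delta(D_i,D_j)=\lambda G^*$; $(q,m,k,\lambda,\mu)$-disjoint (resp. external) partial difference family means $\bigcup_i\Delta(D_i)$ (resp. $\bigcup_{i\neq j}\Delta(D_i,D_j)$) equals $\lambda S+\mu(G^*\setminus S)$; proper means $\lambda\neq\mu$. *)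

(* Defs.v *)
From mathcomp Require Import all_boot all_order all_algebra.
From mathcomp Require Import finmap multiset.

Set Implicit Arguments.
Unset Strict Implicit.
Unset Printing Implicit Defensive.

Import Order.TTheory GRing.Theory Num.Theory.
Local Open Scope ring_scope.
Local Open Scope mset_scope.

Section Definitions.
Variable F : finFieldType.
Implicit Types (alpha : F) (A B D P : {set F}) (DD : {set {set F}}).

Definition Gstar : {set F} := [set~ 0].

Definition scale (a : F) A : {set F} := [set a * x | x in A].

(* The cyclic group generated by x != 0: as x ^+ #|F|.-1 = 1, exponents below
   #|F| already give every power of x. *)
Definition powers (x : F) : {set F} := [set x ^+ j | j : 'I_#|F|].

(* C_i^d *)
Definition cyclotomic_class alpha (d i : nat) : {set F} :=
  scale (alpha ^+ i) (powers (alpha ^+ d)).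

Definition Phi alpha (e eps i : nat) : {set F} :=
  [set x in cyclotomic_class alpha e 0
     | (x != 1) && (x - 1 \in scale (alpha ^+ i) (cyclotomic_class alpha eps 0))].

Definition phi alpha (e eps i : nat) : nat := #|Phi alpha e eps i|.

Definition Delta D : {mset F} :=
  \big[msetD/mset0]_(x in D) \big[msetD/mset0]_(y in D | x != y) [mset x - y].

Definition Delta2 A B : {mset F} :=
  \big[msetD/mset0]_(x in A) \big[msetD/mset0]_(y in B) [mset x - y].

Definition copies (n : nat) A : {mset F} :=
  \big[msetD/mset0]_(x in A) msetn n x.

(* The parameters lambda and mu below are rationals, so that values such as
   (f - 1) / eps or lambda - phi_0 can be written with exact division and
   subtraction; they are required to be natural numbers. *)

Definition uniform_on_Gstar (lambda : rat) (X : {mset F}) : Prop :=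
  exists2 l : nat, lambda = l%:R & X = copies l Gstar.

Definition two_valued (lambda mu : rat) (S : {set F}) (X : {mset F}) : Prop :=
  exists l u : nat, [/\ lambda = l%:R, mu = u%:R &
    X = copies l S `+` copies u (Gstar :\: S)].

Definition partial_difference_set (q k : nat) (lambda mu : rat) P : Prop :=
  [/\ #|F| = q, #|P| = k & two_valued lambda mu P (Delta P)].

Definition proper_partial_difference_set (q k : nat) (lambda mu : rat) P : Prop :=
  partial_difference_set q k lambda mu P /\ lambda <> mu.

Definition disjoint_family (q m k : nat) DD : Prop :=
  [/\ #|F| = q, #|DD| = m, forall D, D \in DD -> #|D| = k /\ D \subset Gstar
    & trivIset DD].

Definition internal_differences DD : {mset F} :=
  \big[msetD/mset0]_(D in DD) Delta D.

Definition external_differences DD : {mset F} :=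
  \big[msetD/mset0]_(A in DD) \big[msetD/mset0]_(B in DD | A != B) Delta2 A B.

Definition disjoint_difference_family (q m k : nat) (lambda : rat) DD : Prop :=
  disjoint_family q m k DD /\
  uniform_on_Gstar lambda (internal_differences DD).

Definition external_difference_family (q m k : nat) (lambda : rat) DD : Prop :=
  disjoint_family q m k DD /\
  uniform_on_Gstar lambda (external_differences DD).

Definition disjoint_partial_difference_family
    (q m k : nat) (lambda mu : rat) DD : Prop :=
  disjoint_family q m k DD /\
  two_valued lambda mu (cover DD) (internal_differences DD).

Definition external_partial_difference_family
    (q m k : nat) (lambda mu : rat) DD : Prop :=
  disjoint_family q m k DD /\
  two_valued lambda mu (cover DD) (external_differences DD).

Definition proper_disjoint_partial_difference_family
    (q m k : nat) (lambda mu : rat) DD : Prop :=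
  disjoint_partial_difference_family q m k lambda mu DD /\ lambda <> mu.

Definition proper_external_partial_difference_family
    (q m k : nat) (lambda mu : rat) DD : Prop :=
  external_partial_difference_family q m k lambda mu DD /\ lambda <> mu.

(* {C_0^e, C_eps^e, ..., C_(e - eps)^e} *)
Definition class_family alpha (e eps : nat) : {set {set F}} :=
  [set cyclotomic_class alpha e (eps * j) | j : 'I_(e %/ eps)].

End Definitions.

(* Main.v *)
Require Import Defs.
From mathcomp Require Import all_boot all_order all_algebra.
From mathcomp Require Import finmap multiset.
From mathcomp Require Import finfield ring.
Import Order.TTheory GRing.Theory Num.Theory.
Local Open Scope ring_scope.

(** A difference inside a class of the family is x - y = y (z - 1) with
    z = x / y in C_0^e.  As y runs over the whole union C_0^eps of the family,
    the value g in C_i^eps is therefore taken exactly phi_i times as an internal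
    difference.  The same count for the one-class family (e = eps) gives the
    multiplicities lambda and mu in Delta(C_0^eps), and the external differences
    are what remains of Delta(C_0^eps) once the internal ones are removed.  The
    constants in (ii) and (iii) come from summing the phi_i over i < eps. *)

(** * Multiplicities of differences, computed pointwise *)

Section Differences.
Local Open Scope mset_scope.
Variable F : finFieldType.
Implicit Types (A B D S : {set F}) (DD : {set {set F}}) (X : {mset F}).

Lemma mset_bigE (I : finType) (P : pred I) (X : I -> {mset F}) (g : F) :
  (\big[msetD/mset0]_(i | P i) X i) g = (\sum_(i | P i) X i g)%N.
Proof.
by apply: (big_morph (fun X : {mset F} => X g)) => [A B|];
  rewrite ?msetE2 ?mset0E.
Qed.

Lemma copiesE n A (g : F) : copies n A g = if g \in A then n else 0%N.
Proof.
rewrite mset_bigE; under eq_bigr do rewrite msetnE.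
rewrite -big_mkcondr /=; case: ifP => gA.
  rewrite (big_pred1 g) // => x /=; case: (eqVneq g x) => [<-|].
    by rewrite gA.
  by rewrite andbF.
by rewrite big_pred0 // => x; case: eqP => [<-|]; rewrite ?gA ?andbF.
Qed.

(** For fixed [y], the only candidate [x] with [x - y = g] is [y + g]. *)
Lemma Delta2E A B (g : F) : Delta2 A B g = (\sum_(y in B) ((y + g)%R \in A))%N.
Proof.
rewrite mset_bigE; under eq_bigr do rewrite mset_bigE.
rewrite exchange_big /=; apply: eq_bigr => y _.
under eq_bigr => x _ do rewrite msetnE eq_sym subr_eq [g + y]addrC.
rewrite -big_mkcondr /=; case: (boolP (y + g \in A)) => gA /=.
  rewrite (big_pred1 (y + g)) // => x /=.
  by case: eqP => [->|]; rewrite ?gA ?andbF.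
by rewrite big_pred0 // => x; case: eqP => [->|]; rewrite ?(negPf gA) ?andbF.
Qed.

Lemma DeltaE D (g : F) : Delta D g = if g == 0 then 0%N else Delta2 D D g.
Proof.
rewrite /Delta /Delta2 !mset_bigE; case: eqP => [->|g0].
  apply: big1 => x _; rewrite mset_bigE big1 // => y /andP[_ nxy].
  by rewrite msetnE eq_sym subr_eq0 (negPf nxy).
apply: eq_bigr => x _; rewrite !mset_bigE [RHS](bigID (fun y => x != y)) /=.
rewrite [X in _ = (_ + X)%N]big1 ?addn0 // => y /andP[_ /negPn/eqP ->].
by rewrite subrr msetnE; case: eqP.
Qed.

Lemma external_differences0 DD : trivIset DD -> external_differences DD 0 = 0%N.
Proof.
move=> /trivIsetP tI; rewrite mset_bigE big1 // => A AD.
rewrite mset_bigE big1 // => B /andP[BD nAB]; rewrite Delta2E big1 // => y yB.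
rewrite addr0; have /pred0P/(_ y) /= := tI _ _ AD BD nAB.
by rewrite yB andbT => ->.
Qed.

Lemma internal_differences0 DD : internal_differences DD 0 = 0%N.
Proof. by rewrite mset_bigE big1 // => A _; rewrite DeltaE eqxx. Qed.

(** Ordered pairs from the union split by their blocks: diagonal block pairs give the internal
    differences, the others the external ones. Disjointness of the blocks makes both sides vanish at
    0. *)
Lemma internal_add_external DD (g : F) : trivIset DD ->
  (internal_differences DD g + external_differences DD g)%N =
  Delta (cover DD) g.
Proof.
move=> tI; rewrite DeltaE; case: eqP => [->|/eqP g0].
  by rewrite internal_differences0 external_differences0.
transitivity (\sum_(A in DD) \sum_(B in DD) Delta2 A B g)%N.
  rewrite /internal_differences /external_differences.
  rewrite (mset_bigE _ _ (@Delta F)) [X in (_ + X)%N]mset_bigE -big_split /=.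
  apply: eq_bigr => A AD; rewrite (mset_bigE _ _ (Delta2 A)) DeltaE (negPf g0).
  rewrite [RHS](bigD1 A) //=; congr addn.
  by apply: eq_bigl => B; rewrite eq_sym.
have Delta2_sum A B : Delta2 A B g =
    (\sum_(x in A) \sum_(y in B) [mset (x - y)%R] g)%N.
  by rewrite mset_bigE; apply: eq_bigr => x _; rewrite mset_bigE.
rewrite Delta2_sum big_trivIset //=; apply: eq_bigr => A _.
under eq_bigr do rewrite Delta2_sum.
rewrite exchange_big /=; apply: eq_bigr => x _.
by rewrite [RHS]big_trivIset.
Qed.

(** Turns an equality of multisets into three pointwise conditions. The value at 0 needs its own
    clause, since 0 lies neither in [S] nor in its complement within [Gstar]. *)
Lemma two_valued_mult S X (l u : nat) : 0 \notin S ->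
  (X = copies l S `+` copies u (Gstar F :\: S)) <->
  [/\ X 0 = 0%N, forall g, g \in S -> X g = l
    & forall g, g != 0 -> g \notin S -> X g = u].
Proof.
move=> S0; split=> [->|[X0 XS XN]].
  split=> [|g gS|g g0 gS]; rewrite msetE2 !copiesE !inE ?eqxx ?(negPf S0) //.
    by rewrite gS addn0.
  by rewrite g0 (negPf gS).
apply/msetP => g; rewrite msetE2 !copiesE !inE.
case: (boolP (g \in S)) => [gS|gS]; first by rewrite XS ?addn0.
by case: eqVneq => [->|g0]; rewrite ?X0 ?XN.
Qed.

(** Both natural multiplicities map to the same rational, hence coincide. *)
Lemma two_valued_uniform S X (lambda : rat) : 0 \notin S ->
  two_valued lambda lambda S X -> uniform_on_Gstar lambda X.
Proof.
move=> S0 [l] [u] [el eu]; have /eqP := etrans (esym el) eu.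
rewrite eqr_nat => /eqP <- /(two_valued_mult _ _ _ _ S0)[X0 XS XN].
exists l => //; apply/msetP => g; rewrite copiesE !inE.
case: eqVneq => [->//|g0] /=.
by case: (boolP (g \in S)) => gS; [apply: XS|apply: XN].
Qed.

End Differences.

(** * Cyclotomic classes through discrete logarithms *)

Section CyclotomicClasses.
Variables (F : finFieldType) (n : nat) (alpha : F).
Hypotheses (hn : n = #|F|.-1) (alphaP : n.-primitive_root alpha).
Implicit Types (x y g : F).
Local Notation C := (cyclotomic_class alpha).

Lemma primitive_power x : x != 0 -> exists k : nat, x = alpha ^+ k.
Proof.
move=> x0; have [|k ->] := prim_rootP alphaP (x := x); last by exists k.
apply: (mulfI x0).
by rewrite mulr1 -exprS hn prednK ?expf_card // (cardD1 x).
Qed.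

Lemma primitive_neq0 : alpha != 0.
Proof.
apply/eqP => a0; have := prim_expr_order alphaP.
rewrite a0 expr0n gtn_eqF ?(prim_order_gt0 alphaP) //= => /eqP.
by rewrite eq_sym oner_eq0.
Qed.

(** Exponents of [alpha] are determined modulo [n], so their residue modulo a divisor [d] of [n] is
    well defined; questions about classes become congruences. *)
Lemma mem_cyclotomic_class d i k : (d %| n)%N ->
  (alpha ^+ k \in C d i) = (k == i %[mod d]).
Proof.
move=> dn; have n0 := prim_order_gt0 alphaP; apply/imsetP/idP.
  case=> _ /imsetP[j _ ->] /eqP.
  rewrite -exprM -exprD (eq_prim_root_expr alphaP) => /eqP kE.
  by rewrite -(modn_dvdm k dn) kE modn_dvdm // mulnC addnC modnMDl.
move=> kE; have d0 : (0 < d)%N by apply: dvdn_gt0 dn.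
(* Adding [n * i] keeps the subtraction of [i] from truncating, and changes neither the power of
   [alpha] nor the residue modulo [d]. *)
have ik : (i <= k + n * i)%N by rewrite (leq_trans _ (leq_addl _ _)) ?leq_pmull.
have dm : (d %| k + n * i - i)%N.
  rewrite -eqn_mod_dvd // -modnDmr; case/dvdnP: dn => m ->.
  by rewrite mulnAC modnMl addn0.
have jlt : ((k + n * i - i) %/ d %% n < #|F|)%N.
  by rewrite (leq_trans (ltn_pmod _ n0)) // hn leq_pred.
exists ((alpha ^+ d) ^+ Ordinal jlt); first by apply/imsetP; exists (Ordinal jlt).
rewrite /= expr_mod; last by rewrite exprAC (prim_expr_order alphaP) expr1n.
rewrite -exprM mulnC divnK // -exprD subnKC //.
by rewrite exprD exprM (prim_expr_order alphaP) expr1n mulr1.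
Qed.

Lemma cyclotomic_class_neq0 d i x : x \in C d i -> x != 0.
Proof.
case/imsetP=> _ /imsetP[j _ ->] ->.
by rewrite -exprM -exprD expf_neq0 ?primitive_neq0.
Qed.

Lemma cyclotomic_class_mulr d i j x y : (d %| n)%N ->
  x \in C d i -> (x * y \in C d (i + j)) = (y \in C d j).
Proof.
move=> dn xC; have x0 := cyclotomic_class_neq0 _ _ _ xC.
case: (eqVneq y 0) => [->|y0].
  by rewrite mulr0; apply/idP/idP => /cyclotomic_class_neq0; rewrite eqxx.
move: xC; have [a ->] := primitive_power _ x0; have [b ->] := primitive_power _ y0.
rewrite -exprD !mem_cyclotomic_class // => /eqP ai.
by rewrite -modnDml ai modnDml eqn_modDl.
Qed.

Lemma card_cyclotomic_class d i : (d %| n)%N -> #|C d i| = (n %/ d)%N.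
Proof.
move=> dn; have n0 := prim_order_gt0 alphaP.
have d0 : (0 < d)%N by apply: dvdn_gt0 dn.
(* The indexing by ['I_#|F|] in [powers] repeats elements; indexing by the exact order of
   [alpha ^+ d] is injective. *)
have beta : (n %/ d).-primitive_root (alpha ^+ d).
  have := dvdn_prim_root alphaP (dvdn_div dn).
  by rewrite divnA // mulKn.
have -> : C d i = [set alpha ^+ i * (alpha ^+ d) ^+ j | j : 'I_(n %/ d)].
  apply/setP => x; apply/imsetP/imsetP => [[_ /imsetP[j _ ->] ->]|[j _ ->]].
    have jlt := ltn_pmod j (prim_order_gt0 beta).
    by exists (Ordinal jlt); rewrite //= (prim_expr_mod beta).
  have jlt : (j < #|F|)%N.
    by rewrite (leq_trans (ltn_ord j)) // (leq_trans (leq_div _ _)) // hn leq_pred.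
  by exists ((alpha ^+ d) ^+ j) => //; apply/imsetP; exists (Ordinal jlt).
rewrite card_imset ?card_ord // => j j' /(mulfI (expf_neq0 i primitive_neq0)) /eqP.
by rewrite (eq_prim_root_expr beta) !modn_small // => /eqP/val_inj.
Qed.

Lemma scale_cyclotomic_class d i : scale (alpha ^+ i) (C d 0) = C d i.
Proof.
rewrite /cyclotomic_class /scale expr0 -imset_comp; apply: eq_imset => x /=.
by rewrite mul1r.
Qed.

Lemma mem_Phi e eps i x :
  (x \in Phi alpha e eps i) = [&& x \in C e 0, x != 1 & x - 1 \in C eps i].
Proof. by rewrite inE scale_cyclotomic_class. Qed.

Lemma cyclotomic_class_inj d i j x : (d %| n)%N ->
  x \in C d i -> x \in C d j -> i = j %[mod d].
Proof.
move=> dn xi; have [k kx] := primitive_power _ (cyclotomic_class_neq0 _ _ _ xi).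
by move: xi; rewrite kx !mem_cyclotomic_class // => /eqP <- /eqP.
Qed.

Lemma cyclotomic_class_exists d x : (d %| n)%N -> x != 0 ->
  exists2 i : nat, (i < d)%N & x \in C d i.
Proof.
move=> dn x0; have d0 := dvdn_gt0 (prim_order_gt0 alphaP) dn.
have [k ->] := primitive_power _ x0; exists (k %% d)%N; first exact: ltn_pmod.
by rewrite mem_cyclotomic_class // modn_mod.
Qed.

(** * The numbers phi_i as multiplicities *)

(** The map sending [y] to [1 + g / y] is a bijection onto [Phi alpha e eps i], with inverse sending
    [z] to [g / (z - 1)]: as [g] is in [C eps i], [y] lies in [C eps 0] exactly when [g / y] lies in
    [C eps i]. *)
Lemma card_quotients e eps i g : (eps %| n)%N -> g \in C eps i ->
  #|[set y in C eps 0 | 1 + g / y \in C e 0]| = phi alpha e eps i.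
Proof.
move=> en gC; have g0 := cyclotomic_class_neq0 _ _ _ gC.
have inj : injective (fun y => 1 + g / y).
  by move=> y y' /addrI/(mulfI g0)/invr_inj.
rewrite -(card_imset _ inj); congr #|pred_of_set _|; apply/setP => z.
rewrite mem_Phi; apply/imsetP/and3P => [[y]|[zC z1 zi]].
  rewrite inE => /andP[yC qC] ->; have y0 := cyclotomic_class_neq0 _ _ _ yC.
  rewrite -subr_eq0 [_ - 1]addrC addKr mulf_neq0 ?invr_neq0 //; split=> //.
  by rewrite -(cyclotomic_class_mulr _ _ _ _ _ en yC) mulrC divfK.
have w0 : z - 1 != 0 by rewrite subr_eq0.
have qz : 1 + g / (g / (z - 1)) = z.
  by rewrite invf_div mulrC divfK // addrC subrK.
exists (g / (z - 1)); last by rewrite qz.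
rewrite inE qz zC andbT -(cyclotomic_class_mulr _ _ _ _ _ en zi) addn0.
by rewrite mulrC divfK.
Qed.

(** Factor [y + g = y * (1 + g / y)]. The summand no longer depends on [i], which lets the sums over
    different classes be merged. *)
Lemma Delta_cyclotomic_class d i g : (d %| n)%N -> g != 0 ->
  Delta (C d i) g = (\sum_(y in C d i) ((1 + g / y)%R \in C d 0))%N.
Proof.
move=> dn g0; rewrite DeltaE (negPf g0) Delta2E; apply: eq_bigr => y yC.
have y0 := cyclotomic_class_neq0 _ _ _ yC.
rewrite -(cyclotomic_class_mulr _ _ 0 _ _ dn yC) addn0.
by rewrite mulrDr mulr1 mulrC divfK.
Qed.

Lemma Delta_cyclotomic_classE d i g : (d %| n)%N -> g \in C d i ->
  Delta (C d 0) g = phi alpha d d i.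
Proof.
move=> dn gC; rewrite -(card_quotients d d i g) //.
rewrite Delta_cyclotomic_class ?(cyclotomic_class_neq0 _ _ _ gC) //.
rewrite -sum1dep_card big_mkcondr; apply: eq_bigr => y _.
by case: (_ \in _).
Qed.

(** The sets Phi_i partition [C e 0] without 1, because each nonzero [x - 1] lies in exactly one
    class of order [eps]. *)
Lemma sum_phi e eps : (e %| n)%N -> (eps %| n)%N ->
  (\sum_(i < eps) phi alpha e eps i)%N = (n %/ e).-1.
Proof.
move=> en epsn.
transitivity (\sum_(i < eps) \sum_(x in C e 0 :\ 1%R)
    ((x - 1)%R \in C eps i))%N.
  apply: eq_bigr => i _; rewrite /phi -sum1_card -big_mkcondr.
  by apply: eq_bigl => x; rewrite mem_Phi !inE andbCA andbA.
rewrite exchange_big /= -(card_cyclotomic_class e 0) //.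
rewrite (cardsD1 1 (C e 0)) -[1%R](expr0 alpha) mem_cyclotomic_class //.
rewrite eqxx add1n /= -sum1_card expr0; apply: eq_bigr => x.
rewrite !inE => /andP[x1 _].
have [|i lti xi] := cyclotomic_class_exists eps (x - 1) epsn.
  by rewrite subr_eq0.
rewrite (bigD1 (Ordinal lti)) //= xi big1 // => j nij.
case xj: (_ \in _) => //; case/eqP: nij; apply: val_inj => /=.
by have := cyclotomic_class_inj _ _ _ _ epsn xj xi; rewrite !modn_small.
Qed.

(** * The family of classes inside [C eps 0] *)

Section ClassFamily.
Variables (e eps : nat).
Hypotheses (en : (e %| n)%N) (epse : (eps %| e)%N).
Local Notation CC := (class_family alpha e eps).
Let epsn : (eps %| n)%N := dvdn_trans epse en.
Let e0 : (0 < e)%N := dvdn_gt0 (prim_order_gt0 alphaP) en.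
Let eps0 : (0 < eps)%N := dvdn_gt0 e0 epse.

(** The offsets [eps * j] stay below [e], so they are distinct residues modulo [e]. *)
Lemma class_family_inj (j j' : 'I_(e %/ eps)) x :
  x \in C e (eps * j) -> x \in C e (eps * j') -> j = j'.
Proof.
move=> xj xj'; have := cyclotomic_class_inj _ _ _ _ en xj xj'.
have lt (k : 'I_(e %/ eps)) : (eps * k < e)%N.
  by rewrite mulnC -ltn_divRL.
by rewrite !modn_small // => /eqP; rewrite eqn_pmul2l // => /eqP/val_inj.
Qed.

Lemma card_class_family : #|CC| = (e %/ eps)%N.
Proof.
rewrite card_imset ?card_ord // => j j' eqC.
have aj : alpha ^+ (eps * j) \in C e (eps * j) by rewrite mem_cyclotomic_class.
by apply: (class_family_inj _ _ _ aj); rewrite -eqC.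
Qed.

Lemma trivIset_class_family : trivIset CC.
Proof.
apply/trivIsetP => _ _ /imsetP[j _ ->] /imsetP[j' _ ->] nC.
apply/pred0P => x /=; apply/negP => /andP[xj xj'].
by case/eqP: nC; rewrite (class_family_inj _ _ _ xj xj').
Qed.

Lemma cover_class_family : cover CC = C eps 0.
Proof.
apply/setP => x; rewrite cover_imset; apply/bigcupP/idP => [[j _ xj]|xC].
  have [k xk] := primitive_power _ (cyclotomic_class_neq0 _ _ _ xj); move: xj.
  rewrite xk !mem_cyclotomic_class // => /eqP kj.
  by rewrite -(modn_dvdm k epse) kj modn_dvdm // modnMr mod0n.
have [k xk] := primitive_power _ (cyclotomic_class_neq0 _ _ _ xC); move: xC.
rewrite xk mem_cyclotomic_class // mod0n => dk.
(* The block containing [alpha ^+ k] has offset [k %% e], a multiple of [eps] because [eps] divides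
   both [k] and [e]. *)
have jlt : ((k %% e) %/ eps < e %/ eps)%N.
  by rewrite ltn_divRL // divnK ?ltn_mod // /dvdn modn_dvdm.
exists (Ordinal jlt); rewrite // mem_cyclotomic_class //= mulnC divnK ?modn_mod //.
by rewrite /dvdn modn_dvdm.
Qed.

Lemma class_family_disjoint : disjoint_family n.+1 (e %/ eps) (n %/ e) CC.
Proof.
split; [|exact: card_class_family| |exact: trivIset_class_family].
  by rewrite hn prednK // (cardD1 0).
move=> _ /imsetP[j _ ->]; split; first exact: card_cyclotomic_class.
by apply/subsetP => x /cyclotomic_class_neq0; rewrite !inE.
Qed.

(** The sums over [y] in the separate blocks join into one sum over the union [C eps 0], which
    [card_quotients] evaluates. *)
Lemma internal_class_family i g : g \in C eps i ->
  internal_differences CC g = phi alpha e eps i.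
Proof.
move=> gC; have g0 := cyclotomic_class_neq0 _ _ _ gC.
rewrite -(card_quotients e eps i g epsn gC) -sum1dep_card big_mkcondr /=.
rewrite -cover_class_family big_trivIset ?trivIset_class_family //=.
rewrite /internal_differences (mset_bigE _ _ _ (@Delta F)).
apply: eq_bigr => _ /imsetP[j _ ->].
by rewrite Delta_cyclotomic_class.
Qed.

Lemma external_class_family i g : g \in C eps i ->
  (phi alpha e eps i + external_differences CC g)%N = phi alpha eps eps i.
Proof.
move=> gC; rewrite -(internal_class_family i g gC).
rewrite internal_add_external ?trivIset_class_family // cover_class_family.
exact: Delta_cyclotomic_classE.
Qed.

End ClassFamily.
End CyclotomicClasses.

(** * The four cases of the theorem *)

Theorem theorem5p4 (F : finFieldType) (q e f eps : nat) (alpha : F)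
    (lambda mu : rat)
    (hF : #|F| = q)
    (hq : q = (e * f + 1)%N)
    (he : (1 < e)%N) (hf : (1 < f)%N)
    (heps : (1 < eps)%N) (heps_dvd : (eps %| e)%N) (heps_lt : (eps < e)%N)
    (halpha : (q.-1).-primitive_root alpha)
    (hpds : proper_partial_difference_set q ((e * f) %/ eps) lambda mu
              (cyclotomic_class alpha eps 0)) :
  ((exists i j : nat, [/\ (1 <= i < eps)%N, (1 <= j < eps)%N, i <> j
      & phi alpha e eps i <> phi alpha e eps j]) ->
    (~ exists (m k : nat) (lambda' mu' : rat),
         disjoint_partial_difference_family q m k lambda' mu'
           (class_family alpha e eps)) /\
    (~ exists (m k : nat) (lambda' mu' : rat),
         external_partial_difference_family q m k lambda' mu'
           (class_family alpha e eps)))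
  /\
  (~ (exists i j : nat, [/\ (1 <= i < eps)%N, (1 <= j < eps)%N, i <> j
      & phi alpha e eps i <> phi alpha e eps j]) ->
    let phi0 : rat := (phi alpha e eps 0)%:R in
    let kappa : rat := (phi alpha e eps 1)%:R - phi0 in
    [/\ kappa = 0 ->
          disjoint_difference_family q (e %/ eps) f ((f%:R - 1) / eps%:R)
            (class_family alpha e eps) /\
          external_partial_difference_family q (e %/ eps) f
            (lambda - (f%:R - 1) / eps%:R) (mu - (f%:R - 1) / eps%:R)
            (class_family alpha e eps),
        kappa = mu - lambda ->
          external_difference_family q (e %/ eps) f
            ((e%:R - eps%:R) * f%:R / eps%:R ^+ 2)
            (class_family alpha e eps) /\
          disjoint_partial_difference_family q (e %/ eps) f
            (lambda - (e%:R - eps%:R) * f%:R / eps%:R ^+ 2)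
            (mu - (e%:R - eps%:R) * f%:R / eps%:R ^+ 2)
            (class_family alpha e eps)
      & kappa <> 0 /\ kappa <> mu - lambda ->
          proper_disjoint_partial_difference_family q (e %/ eps) f
            phi0 (phi0 + kappa) (class_family alpha e eps) /\
          proper_external_partial_difference_family q (e %/ eps) f
            (lambda - phi0) (mu - phi0 - kappa) (class_family alpha e eps)]).
Proof.
have qE : (e * f)%N = #|F|.-1 by rewrite hF hq addn1.
have q1 : q.-1 = (e * f)%N by rewrite hq addn1.
rewrite q1 in halpha.
have en : (e %| e * f)%N by apply: dvdn_mulr.
have e0 : (0 < e)%N by apply: ltnW.
have eps0 : (0 < eps)%N by apply: ltnW.
have epsn : (eps %| e * f)%N by apply: dvdn_mulr.
set DD := class_family alpha e eps.
set S := cyclotomic_class alpha eps 0.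
have S0 : 0 \notin S.
  by apply/negP => /(cyclotomic_class_neq0 _ _ _ halpha); rewrite eqxx.
have covDD : cover DD = S by apply: (cover_class_family _ _ _ qE halpha).
have tDD : trivIset DD by apply: (trivIset_class_family _ _ _ qE halpha).
have dDD : disjoint_family q (e %/ eps) f DD.
  have := class_family_disjoint _ _ _ qE halpha _ _ en heps_dvd.
  by rewrite mulKn // hq addn1.
have classS i : (0 < i < eps)%N -> alpha ^+ i \notin S /\
    alpha ^+ i \in cyclotomic_class alpha eps i.
  move=> /andP[i0 ilt]; rewrite !(mem_cyclotomic_class _ _ _ qE halpha) //.
  by rewrite mod0n modn_small // -lt0n.
have classN g : g != 0 -> g \notin S ->
    exists2 i : nat, (0 < i < eps)%N & g \in cyclotomic_class alpha eps i.
  move=> g0 gS.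
  have [i ilt gi] := cyclotomic_class_exists _ _ _ qE halpha _ _ epsn g0.
  by exists i => //; rewrite ilt andbT lt0n; apply: contraNneq gS => i0; rewrite i0 in gi.
have alpha0 i : alpha ^+ i != 0.
  by rewrite expf_neq0 ?(primitive_neq0 _ _ _ halpha).
have intE := internal_class_family _ _ _ qE halpha _ _ en heps_dvd.
have extE := external_class_family _ _ _ qE halpha _ _ en heps_dvd.
case: hpds => [[_ _ [l [u [lE uE]]]]] /(two_valued_mult _ _ _ _ _ S0)[_ DS DN] _.
(* The partial difference set parameters are themselves the phi_i of the case [e = eps]. *)
have lphi : phi alpha eps eps 0 = l.
  have a0 : alpha ^+ 0 \in S by rewrite (mem_cyclotomic_class _ _ _ qE halpha).
  by rewrite -(DS _ a0) (Delta_cyclotomic_classE _ _ _ qE halpha _ _ _ _ a0).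
have uphi i : (0 < i < eps)%N -> phi alpha eps eps i = u.
  move=> /classS[aN ai].
  by rewrite -(DN _ _ aN) // (Delta_cyclotomic_classE _ _ _ qE halpha _ _ _ _ ai).
have intS := internal_differences0 F DD.
have extS := external_differences0 _ _ tDD.
split.
  (* Both [alpha ^+ i] and [alpha ^+ j] lie outside [S], so a two-valued internal or external
     multiset takes equal values there. This forces phi_i = phi_j, in the external case after
     cancelling from the common total [u]. *)
  case=> i [j [hi hj _ nphi]]; have [aiN ai] := classS i hi.
  have [ajN aj] := classS j hj; split.
    case=> m [k [l' [u' [_ [l1 [u1 [_ _]]]]]]].
    rewrite covDD => /(two_valued_mult _ _ _ _ _ S0)[_ _ XN]; apply: nphi.
    by rewrite -(intE _ _ ai) -(intE _ _ aj) !XN.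
  case=> m [k [l' [u' [_ [l1 [u1 [_ _]]]]]]].
  rewrite covDD => /(two_valued_mult _ _ _ _ _ S0)[_ _ XN]; apply: nphi.
  have := extE _ _ ai; have := extE _ _ aj.
  by rewrite !XN // !uphi // => <- /addIn.
move=> nphi phi0 kappa.
have phiE i : (0 < i < eps)%N -> phi alpha e eps i = phi alpha e eps 1.
  move=> hi; apply/eqP/negPn/negP => /eqP ni; apply: nphi; exists i, 1%N.
  by split=> // i1; apply: ni; rewrite i1.
set phi1 : rat := (phi alpha e eps 1)%:R in kappa *.
have h1 : (0 < 1 < eps)%N by rewrite heps.
have TI : two_valued phi0 phi1 (cover DD) (internal_differences DD).
  exists (phi alpha e eps 0), (phi alpha e eps 1); split=> //.
  rewrite covDD; apply/(two_valued_mult _ _ _ _ _ S0); split=> // [g gS|g g0 gN].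
    exact: intE.
  by have [i hi gi] := classN _ g0 gN; rewrite (intE _ _ gi) phiE.
have [aN a1] := classS 1%N h1.
have TE : two_valued (lambda - phi0) (mu - phi1) (cover DD) (external_differences DD).
  have a0 : alpha ^+ 0 \in S by rewrite (mem_cyclotomic_class _ _ _ qE halpha).
  (* Taking actual multiplicities as witnesses shows that the rational differences are natural
     numbers. *)
  exists (external_differences DD (alpha ^+ 0)), (external_differences DD (alpha ^+ 1)).
  have := extE _ _ a0; rewrite lphi => l0; have := extE _ _ a1; rewrite uphi // => u1.
  split; [by rewrite lE -l0 natrD addrC addKr|by rewrite uE -u1 natrD addrC addKr|].
  rewrite covDD; apply/(two_valued_mult _ _ _ _ _ S0); split=> // [g gS|g g0 gN].
    by apply: (@addnI (phi alpha e eps 0)); rewrite l0 -lphi; apply: extE.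
  have [i hi gi] := classN _ g0 gN; apply: (@addnI (phi alpha e eps 1)).
  by rewrite u1 -(phiE _ hi) -(uphi _ hi); apply: extE.
have epsR : eps%:R != 0 :> rat by rewrite pnatr_eq0 -lt0n.
have sum_const (psi : nat -> nat) c : (forall i, (0 < i < eps)%N -> psi i = c) ->
    (\sum_(i < eps) psi i)%:R = (psi 0%N)%:R + (eps%:R - 1) * c%:R :> rat.
  rewrite -(prednK eps0) => psic.
  rewrite big_ord_recl (eq_bigr (fun _ => c)) => [|i _]; last first.
    by apply: psic; rewrite lift0 /= ltnS ltn_ord.
  by rewrite sum_nat_const card_ord natrD natrM -natr1 addrK.
have sumphi : phi0 + (eps%:R - 1) * phi1 = f%:R - 1.
  rewrite -(sum_const _ _ phiE) (sum_phi _ _ _ qE halpha) // mulKn //.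
  by rewrite -subn1 natrB // ltnW.
(* The same summation with [e = eps]: [lambda + (eps - 1) * mu] equals [e * f / eps - 1]. *)
have sumpsi : eps%:R * (lambda + (eps%:R - 1) * mu + 1) = e%:R * f%:R.
  rewrite lE uE -lphi -(sum_const _ _ uphi) (sum_phi _ _ _ qE halpha) //.
  have kgt0 : (0 < e * f %/ eps)%N.
    by rewrite divn_gt0 // dvdn_leq // muln_gt0 e0 ltnW.
  by rewrite natr1 (prednK kgt0) -!natrM mulnC divnK.
have phi1E : phi1 = phi0 + kappa by rewrite /kappa addrC subrK.
clearbody kappa phi1 phi0.
split=> [k0|kE|[k0 kN]].
(* With [phi1 = phi0], [sumphi] reads [eps * phi0 = f - 1]. *)
- have c : (f%:R - 1) / eps%:R = phi0.
    rewrite -sumphi phi1E k0; field; exact: epsR.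
  rewrite c; move: TI TE; rewrite phi1E k0 addr0 => TI TE.
  by do 2!split=> //; apply: two_valued_uniform TI; rewrite covDD.
- have muE : mu = lambda + kappa by rewrite kE addrC subrK.
  (* Here [e * f] is eliminated by [sumpsi] and [f] by [sumphi]; the multiples of [kappa] cancel. *)
  have c : (e%:R - eps%:R) * f%:R / eps%:R ^+ 2 = lambda - phi0.
    have fE : f%:R = phi0 + (eps%:R - 1) * phi1 + 1 by rewrite sumphi subrK.
    rewrite mulrBl -sumpsi fE phi1E muE; field; exact: epsR.
  have mc : mu - phi1 = lambda - phi0 by rewrite phi1E muE; ring.
  rewrite c; rewrite mc in TE; split; split=> //.
    by apply: two_valued_uniform TE; rewrite covDD.
  by rewrite subKr -mc subKr.
- rewrite -phi1E -[mu - phi0 - kappa]addrA -opprD -phi1E.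
  (* Equal internal values would give [kappa = 0], equal external values [kappa = mu - lambda]. *)
  split; split=> //.
    by rewrite phi1E -[X in X = _]addr0 => /addrI/esym.
  move=> E; apply: kN; have -> : mu = lambda - phi0 + phi1 by rewrite E subrK.
  by rewrite phi1E; ring.
Qed.
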